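(* Let $F(X)=c_0+c_1X+\cdots+c_{d-1}X^{d-1}+X^d\in\mathbb{Z}[X]$ be a monic irreducible polynomial such that $L=\mathbb{Q}(\xi)$ is a Galois extension of $\mathbb{Q}$ of degree $d$, where $\xi$ is a fixed root of $F$, and let $G=\mathrm{Gal}(L/\mathbb{Q})$. Assume that $\{\sigma\xi\}_{\sigma\in G}$ is a $\mathbb{Q}$-basis of $L$ (a normal basis). Let $K_1,\dots,K_r$ be the conjugacy classes of $G$. Define the matrices $$P=[\sigma^{-1}(\xi^{i-1})]_{1\le i\le d,\ \sigma\in G},\qquad \Gamma_\xi=[\sigma\tau^{-1}(\xi)]_{\sigma\in G,\ \tau\in G},\qquad \kappa=[\kappa_{\tau,j}]_{\tau\in G,\ 1\le j\le r},$$ where $\kappa_{\tau,j}=1$ if $\tau\in K_j$ and $\kappa_{\tau,j}=0$ otherwise. Then $\Gamma_\xi$ is invertible, and the $d\times r$ matrix $A=P\,\Gamma_\xi^{-1}\,\kappa$ has rational entries. For each $j$, let $(a_{K_j,i})_{i\ge0}$ be the sequence with characteristic polynomial $F$ (i.e. $a_{K_j,n+d}=-\sum_{k=0}^{d-1}c_k a_{K_j,n+k}$ for all $n\ge 0$) whose first $d$ terms $a_{K_j,0},\dots,a_{K_j,d-1}$ are the entries of the $j$-th column of $A$. Then for all but finitely many primes $p$, $a_{K_j,p}$ is $p$-integral and $$a_{K_j,p}\equiv\begin{cases}1\pmod p&\text{if }\mathrm{Frob}_p\in K_j,\\ 0\pmod p&\text{otherwise.}\end{cases}$$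
   Context: All matrices indexed by $G$ use one fixed total order on $G$, the same for rows and columns. For a prime $p$ unramified in $L$, $\mathrm{Frob}_p$ denotes the conjugacy class in $G$ of the Frobenius automorphisms of the primes of $L$ above $p$; ''$\mathrm{Frob}_p\in K_j$'' means this class equals $K_j$. *)

(* Defs.v *)
From mathcomp Require Import all_boot all_order all_algebra all_fingroup all_field.
Set Implicit Arguments. Unset Strict Implicit. Unset Printing Implicit Defensive.
Import GRing.Theory Num.Theory.
Local Open Scope ring_scope.

Definition alg_integral (L : fieldExtType rat) (x : L) : Prop :=
  exists q : {poly int}, q \is monic /\ root (map_poly (fun z : int => z%:~R : L) q) x.

Definition prime_ideal_above (L : fieldExtType rat) (p : nat) (P : L -> Prop) : Prop :=
  (forall x, P x -> alg_integral x) /\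
  P 0 /\
  (forall x y, P x -> P y -> P (x + y)) /\
  (forall x y, alg_integral y -> P x -> P (y * x)) /\
  ~ P 1 /\
  (forall x y, alg_integral x -> alg_integral y -> P (x * y) -> P x \/ P y) /\
  P p%:R.

Definition is_frobenius (L : splittingFieldType rat) (p : nat) (P : L -> Prop)
    (s : gal_of {:L}) : Prop :=
  forall x, alg_integral x -> P (s x - x ^+ p).

Definition frob_in (L : splittingFieldType rat) (p : nat) (K : {set gal_of {:L}}) : Prop :=
  forall s, (exists P, prime_ideal_above p P /\ is_frobenius p P s) <-> s \in K.

Definition p_integral (p : nat) (a : rat) : Prop := ~~ (p %| `|denq a|)%N.
Definition cong_mod_p (p : nat) (a b : rat) : Prop := p_integral p ((a - b) / p%:R).

Definition gal_at (L : splittingFieldType rat) (i : 'I_#|{: gal_of {:L}}|) : gal_of {:L} :=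
  enum_val i.
Definition class_at (L : splittingFieldType rat)
    (j : 'I_#|classes [set: gal_of {:L}]|) : {set gal_of {:L}} := enum_val j.

Definition Pmat (L : splittingFieldType rat) (d : nat) (xi : L)
  : 'M[L]_(d, #|{: gal_of {:L}}|) :=
  \matrix_(i < d, s < #|{: gal_of {:L}}|) ((gal_at s)^-1)%g (xi ^+ i).

Definition Gammamat (L : splittingFieldType rat) (xi : L) : 'M[L]_(#|{: gal_of {:L}}|) :=
  \matrix_(s, t) (gal_at s) (((gal_at t)^-1)%g xi).

Definition kappamat (L : splittingFieldType rat)
  : 'M[L]_(#|{: gal_of {:L}}|, #|classes [set: gal_of {:L}]|) :=
  \matrix_(t, j) (if gal_at t \in class_at j then 1 else 0).

(* Main.v *)
(* Solving the linear system for a class K with Gamma_xi and applying an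
   automorphism to it shows that its solution is of the form t |-> t^-1 w for a
   single w in L, because K is stable under conjugation.  Hence a_n is the trace
   of xi^n w for every n: it is rational, satisfies the recurrence, and
   a_p = sum_t (t^-1 xi)^p t^-1 w.  If s is a Frobenius at P | p, then modulo P
   this is sum_t s (t^-1 xi) t^-1 w, which is the indicator of s \in K by the
   choice of w; for p prime to a denominator of w this descends to a congruence
   modulo p.

   Outside the primes dividing the N with N O_L <= Z[xi], a prime above p comes
   from a root of F in characteristic p, and the existence of a Frobenius at it
   from F(xi^p) = F(xi)^p = 0 mod p.  When the Frobenius class is not K, some
   Frobenius element lies outside K: the Frobenius elements are closed under
   conjugation, so if all of them were in K they would exhaust it. *)
Require Import Defs.
From mathcomp Require Import all_boot all_order all_algebra all_fingroup all_field ring.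
Set Implicit Arguments.
Unset Strict Implicit.
Unset Printing Implicit Defensive.
Import GRing.Theory Num.Theory.
Local Open Scope ring_scope.

(* [fieldext] has a lemma of the same name. *)
Local Notation alg_integral := Defs.alg_integral.

(** * Algebraic integers in [L] *)

Section AlgIntegral.
Variable L : fieldExtType rat.
Implicit Types x y : L.

Lemma alg_integralE x : alg_integral x <-> integralOver (intr : int -> L) x.
Proof. by split=> [[q [mq rq]]|[q mq rq]]; exists q. Qed.

Lemma alg_integral_int (n : int) : alg_integral (n%:~R : L).
Proof. exact/alg_integralE/integral_id. Qed.

Lemma alg_integral_nat (n : nat) : alg_integral (n%:R : L).
Proof. exact: alg_integral_int n. Qed.

Lemma alg_integralD x y :
  alg_integral x -> alg_integral y -> alg_integral (x + y).
Proof.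
by move=> /alg_integralE ix /alg_integralE iy; apply/alg_integralE/integral_add.
Qed.

Lemma alg_integralM x y :
  alg_integral x -> alg_integral y -> alg_integral (x * y).
Proof.
by move=> /alg_integralE ix /alg_integralE iy; apply/alg_integralE/integral_mul.
Qed.

Lemma alg_integralB x y :
  alg_integral x -> alg_integral y -> alg_integral (x - y).
Proof.
by move=> /alg_integralE ix /alg_integralE iy; apply/alg_integralE/integral_sub.
Qed.

Lemma alg_integralX x n : alg_integral x -> alg_integral (x ^+ n).
Proof.
move=> ix; elim: n => [|n IHn]; first exact: alg_integral_nat 1%N.
by rewrite exprS; apply: alg_integralM.
Qed.

Lemma alg_integral_sum I (r : seq I) (P : pred I) (E : I -> L) :
  (forall i, P i -> alg_integral (E i)) ->
  alg_integral (\sum_(i <- r | P i) E i).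
Proof.
by move=> iE; apply: big_ind => //; [apply: alg_integral_nat 0%N | apply: alg_integralD].
Qed.

Lemma alg_integral_horner (h : {poly int}) x :
  alg_integral x -> alg_integral (map_poly intr h).[x].
Proof.
move=> ix; rewrite horner_coef; apply: alg_integral_sum => i _.
by rewrite coef_map; apply/alg_integralM/alg_integralX=> //; apply: alg_integral_int.
Qed.

Lemma alg_integral_rmorph (f : {rmorphism L -> L}) x :
  alg_integral x -> alg_integral (f x).
Proof.
case=> q [mq /eqP rq]; exists q; split=> //; apply/eqP.
have -> : map_poly (fun z : int => z%:~R : L) q = map_poly f (map_poly intr q).
  by rewrite -map_poly_comp; apply: eq_map_poly => z /=; rewrite rmorph_int.
by rewrite horner_map rq rmorph0.
Qed.

Lemma in_alg_int (z : int) : (z%:~R : rat)%:A = z%:~R :> L.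
Proof. exact: (rmorph_int (in_alg L)). Qed.

(** The monic relation descends to [rat]; read in [algC], a rational algebraic integer is an
    integer. *)
Lemma alg_integral_rat (a : rat) :
  alg_integral (a%:A : L) -> exists z : int, a = z%:~R.
Proof.
case=> q [mq rq].
have {}rq : root (map_poly intr q) a.
  rewrite -(fmorph_root (in_alg L)) -map_poly_comp.
  congr (is_true (root _ _)): rq; apply: eq_map_poly => z /=.
  by rewrite in_alg_int.
have: ratr a \in Aint.
  apply: (@root_monic_Aint (map_poly (intr : int -> algC) q)).
  - have -> : map_poly (intr : int -> algC) q = map_poly ratr (map_poly intr q).
      by rewrite -map_poly_comp; apply: eq_map_poly => z /=; rewrite ratr_int.
    by rewrite fmorph_root.
  - exact: monic_map.
  - by apply/polyOverP => i; rewrite coef_map /= rpred_int.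
move/(Cint_rat_Aint (Crat_rat a)) => /intrP [z]; rewrite -ratr_int => /fmorph_inj ->.
by exists z.
Qed.

End AlgIntegral.

(** * [p]-integrality from a denominator prime to [p] *)

Lemma p_integral_div (p : nat) (x : rat) (D m : int) :
  prime p -> ~~ (p %| D)%Z -> D%:~R * x = m%:~R -> p_integral p x.
Proof.
move=> pp pD Dx; apply: contra pD => pd.
(* Numerator and denominator are coprime, so [D * numq x = m * denq x] forces [denq x] to divide
   [D]. *)
have den : (denq x %| D)%Z.
  have: D * numq x = m * denq x.
    apply: (@intr_inj rat); rewrite !rmorphM /= -Dx -mulrA; congr (_ * _).
    by rewrite numqE.
  move=> e; have : (denq x %| D * numq x)%Z by rewrite e dvdz_mull.
  by rewrite Gauss_dvdzl // coprimezE coprime_sym; exact: coprime_num_den.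
by apply: dvdz_trans den; rewrite dvdzE.
Qed.

Lemma cong_mod_p_div (p : nat) (a b : rat) (D m : int) :
  prime p -> ~~ (p %| D)%Z -> D%:~R * (a - b) = p%:R * m%:~R -> cong_mod_p p a b.
Proof.
move=> pp pD e; apply: (@p_integral_div p _ D m) => //.
rewrite mulrA e mulrAC mulfV ?mul1r // pnatr_eq0 -lt0n prime_gt0 //.
Qed.

(** * Prime ideals above [p] *)

Section Primes.
Variable L : splittingFieldType rat.
Variables (p : nat) (P : L -> Prop).
Hypotheses (pp : prime p) (PP : prime_ideal_above p P).

Lemma prime_ideal_sum I (r : seq I) (Q : pred I) (E : I -> L) :
  (forall i, Q i -> P (E i)) -> P (\sum_(i <- r | Q i) E i).
Proof. by case: PP => _ [P0 [PD _]] PE; apply: big_ind. Qed.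

Lemma prime_ideal_mull x y : alg_integral y -> P x -> P (y * x).
Proof. by case: PP => _ [_ [_ [PM _]]]; apply: PM. Qed.

Lemma prime_idealD x y : P x -> P y -> P (x + y).
Proof. by case: PP => _ [_ [PD _]]; apply: PD. Qed.

Lemma prime_idealN x : P x -> P (- x).
Proof.
move=> Px; rewrite -mulN1r; apply: prime_ideal_mull => //.
exact: (@alg_integral_int L (-1)).
Qed.

Lemma prime_idealM x y :
  alg_integral x -> alg_integral y -> P (x * y) -> P x \/ P y.
Proof. by case: PP => _ [_ [_ [_ [_ [H _]]]]]; apply: H. Qed.

(** By Bezout, an integer of [P] prime to [p] would put 1 in [P]. *)
Lemma prime_ideal_int (n : int) : P n%:~R -> (p %| n)%Z.
Proof.
have [_ [_ [_ [_ [P1 [_ Pp]]]]]] := PP.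
move=> Pn; apply/negPn/negP=> pn; apply: P1.
have /coprimezP [[u v] /= e] : coprimez p n by rewrite coprimezE prime_coprime.
rewrite -[1]/(1%:~R) -e rmorphD !rmorphM /=.
by apply: prime_idealD; apply: prime_ideal_mull => //; apply: alg_integral_int.
Qed.

Lemma prime_ideal_prod I (r : seq I) (E : I -> L) :
  (forall i, alg_integral (E i)) -> P (\prod_(i <- r) E i) -> exists i, P (E i).
Proof.
have [_ [_ [_ [_ [P1 _]]]]] := PP.
move=> iE; elim: r => [|i r IHr]; first by rewrite big_nil.
have ir : alg_integral (\prod_(j <- r) E j).
  by apply: big_ind => //; [apply: (alg_integral_nat L 1) | apply: alg_integralM].
by rewrite big_cons => /(prime_idealM (iE i) ir) [Pi|/IHr //]; exists i.
Qed.

(** This removes a factor [N] that was introduced to reach Z[xi]. *)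
Lemma prime_ideal_cancel (N : int) x :
  ~~ (p %| N)%Z -> alg_integral x -> P (N%:~R * x) -> P x.
Proof.
move=> pN ix /(prime_idealM (alg_integral_int L N) ix) [|//].
by move/prime_ideal_int; rewrite (negPf pN).
Qed.

End Primes.

(** * Polynomials modulo [p] *)

Section CharP.
Variable p : nat.
Hypothesis pp : prime p.

(** The Frobenius of the polynomial ring fixes the coefficients in ['F_p] and sends ['X] to
    ['X^p]. *)
Lemma Fp_poly_pow (k : {poly 'F_p}) : k ^+ p = k \Po 'X^p.
Proof.
have chP : p \in [pchar {poly 'F_p}] by rewrite pchar_poly pchar_Fp.
elim/poly_ind: k => [|k c IH].
  by rewrite comp_poly0 expr0n -(prednK (prime_gt0 pp)).
rewrite comp_poly_MXaddC -IH -!(pFrobenius_autE chP) rmorphD rmorphM /=.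
congr (_ * _ + _).
by have := expf_card c; rewrite card_Fp // pFrobenius_autE -rmorphXn /= => ->.
Qed.

Lemma int_poly_pow (h : {poly int}) :
  exists r, h ^+ p = (h \Po 'X^p) + p%:R * r.
Proof.
pose g := h ^+ p - (h \Po 'X^p).
have g0 : map_poly (intr : int -> 'F_p) g = 0.
  by rewrite rmorphB rmorphXn /= map_comp_poly map_polyXn Fp_poly_pow subrr.
exists (\poly_(i < size g) (g`_i %/ p)%Z); apply/eqP.
rewrite addrC -subr_eq -/g; apply/eqP/polyP => i.
rewrite mulr_natl coefMn coef_poly -mulr_natl.
case: ltnP => [_|/leq_sizeP -> //]; last by rewrite mulr0.
have : (p %| g`_i)%Z.
  by rewrite (dvdz_pcharf (pchar_Fp pp)) -[_%:~R](coef_map (intr : int -> 'F_p)) g0 coef0.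
by rewrite mulrC => /divzK; rewrite natz.
Qed.

Lemma monic_root_mod_p (F : {poly int}) :
  F \is monic -> (1 < size F)%N ->
  exists K : fieldType, p \in [pchar K] /\ exists t : K, root (map_poly intr F) t.
Proof.
move=> mF sF; pose Fp := map_poly (intr : int -> 'F_p) F.
have mFp : Fp \is monic by apply: monic_map.
(* [K] splits [F] modulo [p]; the list of roots is nonempty because the monic [F] keeps its
   degree. *)
have [K [rs]] := FinSplittingFieldFor (monic_neq0 mFp).
rewrite -map_poly_comp => /= eF _; exists K; split; first by rewrite pchar_lalg pchar_Fp.
have {eF} : map_poly (intr : int -> K) F %= \prod_(z <- rs) ('X - z%:P).
  by congr (is_true (_ %= _)): eF; apply: eq_map_poly => z;
    apply: (rmorph_int (in_alg K)).
case: rs => [|t rs] eF.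
  move: (eqp_size eF); rewrite big_nil size_poly1 size_map_poly_id0 => [e|].
    by rewrite e in sF.
  by rewrite (monicP mF) oner_neq0.
by exists t; rewrite (eqp_root eF) big_cons rootM root_XsubC eqxx.
Qed.

End CharP.

(** * Galois action, normal basis and the index of Z[xi] *)

Section NormalBasis.
Variables (L : splittingFieldType rat) (F : {poly int}) (xi : L).
Hypothesis mF : F \is monic.
Hypothesis irrF : irreducible_poly (map_poly (intr : int -> rat) F).
Hypothesis rootF : root (map_poly (intr : int -> L) F) xi.
Hypothesis gen : <<1; xi>>%VS = fullv.
Hypothesis galL : galois 1%VS {:L}.
Hypothesis dimL : \dim {:L} = (size F).-1.
Hypothesis basisL :
  basis_of fullv (map (fun s : gal_of {:L} => s xi) (enum [set: gal_of {:L}])).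

Local Notation G := (gal_of {:L}).

Lemma map_intr_in_alg (h : {poly int}) :
  map_poly (intr : int -> L) h = map_poly (in_alg L) (map_poly intr h).
Proof.
by rewrite -map_poly_comp; apply: eq_map_poly => z; rewrite /= in_alg_int.
Qed.

Lemma alg_integral_xi : alg_integral xi.
Proof. by exists F. Qed.

Lemma alg_integral_gal (s : G) x : alg_integral x -> alg_integral (s x).
Proof. exact: alg_integral_rmorph. Qed.

Lemma galE (s t : G) x : (s * t)%g x = t (s x).
Proof. by rewrite galM ?memvf. Qed.

Lemma galVK (s : G) x : s (s^-1%g x) = x.
Proof. by rewrite -galE mulVg gal_id. Qed.

Lemma gal_fixed_rat x : (forall s : G, s x = x) -> exists a : rat, x = a%:A.
Proof.
move=> fx; apply/vlineP; have /galois_fixedField <- := galL.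
by apply/fixedFieldP; rewrite ?memvf.
Qed.

Lemma gal_rat (s : G) (a : rat) : s a%:A = a%:A.
Proof. by rewrite linearZ /= rmorph1. Qed.

(* [F] is monic, so an integer polynomial vanishing at [xi] has remainder of
   degree less than [deg F], and irreducibility over [rat] kills it. *)
Lemma int_poly_root_dvd (h : {poly int}) :
  (map_poly (intr : int -> L) h).[xi] = 0 -> exists q, h = q * F.
Proof.
move=> h0; have e := Pdiv.RingMonic.rdivp_eq mF h.
set q := Pdiv.CommonRing.rdivp _ _ in e; set r := Pdiv.CommonRing.rmodp _ _ in e.
have sr : (size r < size F)%N by apply: Pdiv.Ring.ltn_rmodpN0; apply: monic_neq0.
have r0 : (map_poly (intr : int -> L) r).[xi] = 0.
  by move: h0; rewrite e rmorphD rmorphM /= hornerD hornerM (rootP rootF) mulr0 add0r.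
have [r_eq0|rn0] := eqVneq r 0; first by exists q; rewrite {1}e r_eq0 addr0.
have : ~~ coprimep (map_poly (intr : int -> rat) F) (map_poly intr r).
  apply/negP; rewrite -(coprimep_map (in_alg L)) -!map_intr_in_alg.
  by move=> /coprimep_root /(_ rootF); rewrite r0 eqxx.
rewrite irreducible_poly_coprime // negbK => /dvdp_leq.
have szm (k : {poly int}) : size (map_poly (intr : int -> rat) k) = size k.
  by rewrite size_map_inj_poly //; apply: intr_inj.
rewrite !szm leqNgt sr => /(_ _)/negP[] //.
by rewrite -size_poly_eq0 szm size_poly_eq0.
Qed.

(** Each element of [L] is a rational polynomial in [xi]; the product of the denominators of a
    finite family brings the whole family into Z[xi]. *)
Lemma common_denominator (T : finType) (E : T -> L) :
  exists2 D : int, D != 0 &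
    exists h : T -> {poly int}, forall t, D%:~R * E t = (map_poly intr (h t)).[xi].
Proof.
have den1 x : exists Dh : int * {poly int},
    Dh.1 != 0 /\ Dh.1%:~R * x = (map_poly intr Dh.2).[xi].
  have /Fadjoin_polyP [q' /polyOver1P [q ->] ->] : x \in <<1; xi>>%VS.
    by rewrite gen memvf.
  have [h [a an0 ->]] := rat_poly_scale q; exists (a, h); split=> //=.
  rewrite map_intr_in_alg map_polyZ hornerZ mulrA.
  by rewrite -in_alg_int -(rmorphM (in_alg L)) mulfV ?intr_eq0 // rmorph1 mul1r.
have [f fP] := fin_all_exists (fun t => den1 (E t)).
exists (\prod_t (f t).1); first by apply/prodf_neq0 => t _; case: (fP t).
exists (fun t => (\prod_(u | u != t) (f u).1) *: (f t).2) => t.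
have [_ e] := fP t.
by rewrite (bigD1 t) //= intrM -mulrA mulrCA e map_polyZ hornerZ.
Qed.

Lemma normal_basis_decomp x :
  exists c : G -> rat, x = \sum_(t : G) (c t)%:A * (t^-1)%g xi.
Proof.
suff [c ->] : exists c : G -> rat, x = \sum_(t : G) c t *: t xi.
  exists (fun t => c t^-1%g); rewrite (reindex_inj invg_inj) /=.
  by apply: eq_bigr => t _; rewrite mulr_algl.
have : x \in <<map (fun s : G => s xi) (enum [set: G])>>%VS.
  by rewrite (span_basis basisL) memvf.
elim: (enum _) x => [|s r IHr] x.
  rewrite span_nil memv0 => /eqP ->; exists (fun=> 0).
  by rewrite big1 // => t _; rewrite scale0r.
rewrite span_cons => /memv_addP [_ /vlineP [k ->] [y /IHr [c ->] ->]].
exists (fun t => (t == s)%:R * k + c t).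
rewrite [in RHS](eq_bigr _ (fun t _ => scalerDl _ _ _)) big_split; congr (_ + _).
by rewrite (bigD1 s) //= eqxx mul1r big1 ?addr0 // => t /negPf ->; rewrite mul0r scale0r.
Qed.

(** The [t^-1 xi] span [L] over the rationals, so the relation holds at every element of [L];
    Dedekind independence of automorphisms then kills the coefficients. *)
Lemma normal_basis_ext (c : G -> L) :
  (forall t : G, \sum_(s : G) c s * s (t^-1 xi)%g = 0) -> forall s, c s = 0.
Proof.
move=> c0 s; apply: (@gal_independent _ _ _ predT) => // x _.
have [a ->] := normal_basis_decomp x.
under eq_bigr => u _ do rewrite rmorph_sum /= mulr_sumr.
rewrite exchange_big big1 // => t _.
transitivity ((a t)%:A * \sum_(u : G) c u * u (t^-1%g xi)); last by rewrite c0 mulr0.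
rewrite mulr_sumr; apply: eq_bigr => u _.
by rewrite rmorphM /= gal_rat mulrCA.
Qed.

Lemma gal_at_rank (s : G) : gal_at (enum_rank s) = s.
Proof. exact: enum_rankK. Qed.

Lemma enum_rank_gal_at i : enum_rank (@gal_at L i) = i.
Proof. exact: enum_valK. Qed.

Lemma sum_gal_at (E : G -> L) : \sum_i E (gal_at i) = \sum_(s : G) E s.
Proof.
rewrite (reindex_onto enum_rank (@gal_at L)) => [|i _]; last exact: enum_valK.
apply: eq_big => s; rewrite ?gal_at_rank ?eqxx //.
Qed.

Lemma Gammamat_unit : Gammamat xi \in unitmx.
Proof.
rewrite unitmxE unitfE; apply/det0P => -[v /eqP vn0 v0]; apply: vn0.
have v_eq0 := @normal_basis_ext (fun s => v 0 (enum_rank s)).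
apply/rowP => i; rewrite mxE -[i]enum_valK v_eq0 // => t.
have /rowP/(_ (enum_rank t)) := v0; rewrite !mxE => e; apply: etrans e.
rewrite -sum_gal_at; apply: eq_bigr => j _.
by rewrite mxE gal_at_rank enum_rank_gal_at.
Qed.

(* Solve for the normal-basis coordinates [c] of [x] in [s x = \sum_t s (t^-1 xi) c t]
   with [Gammamat xi]: the denominators of the inverse matrix bound those of [c]. *)
Lemma integral_index :
  exists2 N : int, N != 0 & forall x, alg_integral x ->
    exists h : {poly int}, N%:~R * x = (map_poly intr h).[xi].
Proof.
have [D Dn0 [h hP]] := common_denominator
  (fun ij => invmx (Gammamat xi) ij.1 ij.2).
(* The factor [D] will make the coordinates of [x] integers; [D'] is there because the conjugates
   [t^-1 xi] need not lie in Z[xi]. *)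
have [D' D'n0 [h' h'P]] := common_denominator (fun t : G => (t^-1)%g xi).
exists (D * D'); first by rewrite mulf_neq0.
move=> x ix; have [c xE] := normal_basis_decomp x.
have cE t : (c t)%:A = \sum_(s : G) invmx (Gammamat xi) (enum_rank t) (enum_rank s) * s x.
  pose C := \col_i (c (@gal_at L i))%:A : 'cV[L]_#|{: G}|.
  pose X := \col_i (gal_at i x) : 'cV[L]_#|{: G}|.
  have GC : Gammamat xi *m C = X.
    apply/colP => i; rewrite !mxE [in RHS]xE rmorph_sum /= -sum_gal_at.
    by apply: eq_bigr => j _; rewrite !mxE rmorphM /= gal_rat mulrC.
  have /colP/(_ (enum_rank t)) : C = invmx (Gammamat xi) *m X.
    by rewrite -GC mulKmx // Gammamat_unit.
  rewrite !mxE gal_at_rank => ->; rewrite -sum_gal_at; apply: eq_bigr => j _.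
  by rewrite mxE enum_rank_gal_at.
(* [D] times an entry of the inverse matrix is integral, and so is [s x]; the rational [D * c t] is
   therefore an integer. *)
have Dc t : exists z : int, D%:~R * c t = z%:~R.
  apply: (@alg_integral_rat L); rewrite -scalerA scaler_int -mulrzl cE.
  rewrite mulr_sumr; apply: alg_integral_sum => s _.
  rewrite mulrA; apply: alg_integralM; last exact: alg_integral_gal.
  rewrite (hP (enum_rank t, enum_rank s)).
  exact: alg_integral_horner alg_integral_xi.
have [z zP] := fin_all_exists Dc.
exists (\sum_t z t *: h' t); rewrite {1}xE mulr_sumr rmorph_sum /= horner_sum.
apply: eq_bigr => t _; rewrite map_polyZ hornerZ -h'P /=.
have -> : (z t)%:~R = D%:~R * (c t)%:A :> L.
  by rewrite -in_alg_int -zP -scalerA scaler_int mulrzl.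
by rewrite intrM mulrACA.
Qed.


(** * Existence of primes above [p], and the factorisation of [F] *)

Lemma size_F_gt1 : (1 < size F)%N.
Proof.
have [] := irrF; rewrite size_map_inj_poly //; exact: intr_inj.
Qed.

(** Sending [xi] to a root [th] of [F] in characteristic [p] reduces Z[xi] into a field. The prime
    consists of the integral elements having a multiple, by an integer prime to [p], in the kernel
    of this reduction. *)
Lemma exists_prime_above (p : nat) (N : int) :
  prime p -> ~~ (p %| N)%Z ->
  (forall x, alg_integral x ->
    exists h : {poly int}, N%:~R * x = (map_poly intr h).[xi]) ->
  exists P : L -> Prop, prime_ideal_above p P.
Proof.
move=> pp pN NP; have [K [chK [th rth]]] := monic_root_mod_p pp mF size_F_gt1.
pose ev (h : {poly int}) := (map_poly (intr : int -> K) h).[th].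
pose vL (h : {poly int}) := (map_poly (intr : int -> L) h).[xi].
have evD g h : ev (g + h) = ev g + ev h by rewrite /ev rmorphD hornerD.
have evM g h : ev (g * h) = ev g * ev h by rewrite /ev rmorphM hornerM.
have evZ m h : ev (m *: h) = m%:~R * ev h by rewrite /ev map_polyZ hornerZ.
have vLD g h : vL (g + h) = vL g + vL h by rewrite /vL rmorphD hornerD.
have vLM g h : vL (g * h) = vL g * vL h by rewrite /vL rmorphM hornerM.
have vLZ m h : vL (m *: h) = m%:~R * vL h by rewrite /vL map_polyZ hornerZ.
have pK (m : int) : (m%:~R == 0 :> K) = (p %| m)%Z by rewrite (dvdz_pcharf chK).
(* Evaluation at [th] is well defined on Z[xi]: two polynomials with the same value at [xi] differ
   by a multiple of [F]. *)
have ev0 g h : vL g = vL h -> ev g = ev h.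
  move=> e; have /int_poly_root_dvd [q eq] : vL (g - h) = 0.
    by rewrite -scaleN1r vLD vLZ e mulN1r subrr.
  by rewrite -[g](subrK h) evD eq evM /ev (rootP rth) mulr0 add0r.
exists (fun x => alg_integral x /\ exists (m : int) (h : {poly int}),
  [/\ ~~ (p %| m)%Z, m%:~R * x = vL h & ev h = 0]).
have pM (m n : int) : ~~ (p %| m)%Z -> ~~ (p %| n)%Z -> ~~ (p %| m * n)%Z.
  by rewrite -!pK intrM mulf_eq0 => /negPf -> /negPf ->.
split=> [x []//|]; split.
  split; first exact: alg_integral_nat L 0.
  by exists N, 0; split; rewrite // /vL /ev rmorph0 horner0 ?mulr0.
split=> [x y [ix [m [h [pm hE eh]]]] [iy [n [g [pn gE eg]]]]|].
  split; first exact: alg_integralD.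
  exists (m * n), (n *: h + m *: g); split; first exact: pM.
    by rewrite vLD !vLZ -hE -gE intrM; ring.
  by rewrite evD !evZ eh eg !mulr0 addr0.
split=> [x y iy [ix [m [h [pm hE eh]]]]|].
  split; first exact: alg_integralM.
  have [g gE] := NP y iy; exists (N * m), (g * h); split; first exact: pM.
    by rewrite vLM -hE -[vL g]gE intrM mulrACA.
  by rewrite evM eh mulr0.
split=> [[_ [m [h [pm hE eh]]]]|].
  have := ev0 h m%:P; rewrite -hE mulr1 /vL map_polyC hornerC => /(_ erefl)/eqP.
  by rewrite eh /ev map_polyC hornerC eq_sym pK (negPf pm).
split=> [x y ix iy [_ [m [k [pm kE ek]]]]|].
  have [g gE] := NP x ix; have [h hE] := NP y iy.
  (* The identity [m (N x) (N y) = N^2 (m x y)] holds in Z[xi]; its right side reduces to 0 and [m]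
     does not, so [N x] or [N y] does. *)
  have /eqP : ev (m *: (g * h)) = ev ((N * N) *: k).
    apply: ev0; rewrite !vLZ vLM -[vL g]gE -[vL h]hE -kE intrM; ring.
  rewrite !evZ evM ek mulr0 !mulf_eq0 pK (negPf pm) /=.
  by case/orP => /eqP e0; [left | right]; split=> //; [exists N, g | exists N, h].
split; first exact: alg_integral_nat.
exists 1, p%:R; split; first by rewrite dvdzE /= dvdn1 neq_ltn prime_gt1 ?orbT.
  by rewrite mul1r /vL rmorph_nat -polyC_natr hornerC.
by rewrite /ev rmorph_nat -polyC_natr hornerC (pcharf0 chK).
Qed.

(** The conjugates of [xi] are roots of [F], distinct because they form a basis, and as many as the
    degree of [F]. *)
Lemma F_prod : map_poly (intr : int -> L) F = \prod_(s : G) ('X - (s xi)%:P).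
Proof.
have mFL : map_poly (intr : int -> L) F \is monic by apply: monic_map.
rewrite [LHS](@all_roots_prod_XsubC _ _ (map (fun s : G => s xi) (enum [set: G]))).
- by rewrite (monicP mFL) scale1r big_map big_enum; apply: eq_bigl => s; rewrite inE.
- rewrite size_map -cardE -(size_basis basisL) dimL prednK ?(ltnW size_F_gt1) //.
  by rewrite map_intr_in_alg size_map_poly size_map_inj_poly //; apply: intr_inj.
- apply/allP => _ /mapP [s _ ->].
  have -> : map_poly intr F = map_poly s (map_poly intr F).
    by rewrite -map_poly_comp; apply: eq_map_poly => z /=; rewrite rmorph_int.
  by rewrite fmorph_root.
- by rewrite uniq_rootsE free_uniq // (basis_free basisL).
Qed.

(** * Frobenius elements *)

Section Frobenius.
Variables (p : nat) (P : L -> Prop).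
Hypotheses (pp : prime p) (PP : prime_ideal_above p P).

Lemma prime_ideal_mulp x : alg_integral x -> P (p%:R * x).
Proof.
case: (PP) => _ [_ [_ [_ [_ [_ Pp]]]]] ix.
by rewrite mulrC; apply: (prime_ideal_mull PP).
Qed.

Lemma horner_pow_mod (h : {poly int}) x : alg_integral x ->
  P ((map_poly intr h).[x ^+ p] - (map_poly intr h).[x] ^+ p).
Proof.
move=> ix; have [r /(congr1 (map_poly (intr : int -> L)))] := int_poly_pow pp h.
rewrite rmorphXn rmorphD /= map_comp_poly map_polyXn rmorphM rmorph_nat /=.
move/(congr1 (horner^~ x)); rewrite horner_exp hornerD horner_comp hornerXn => ->.
rewrite opprD addNKr hornerM -polyC_natr hornerC -mulrN.
apply: prime_ideal_mulp; rewrite -mulN1r; apply: alg_integralM.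
  exact: alg_integral_int L (-1).
exact: alg_integral_horner.
Qed.

Lemma horner_mod (h : {poly int}) x y : alg_integral x -> alg_integral y ->
  P (x - y) -> P ((map_poly intr h).[x] - (map_poly intr h).[y]).
Proof.
move=> ix iy Pxy; elim/poly_ind: h => [|h c IH].
  by rewrite rmorph0 !horner0 subrr; case: PP => _ [].
rewrite rmorphD rmorphM /= map_polyX map_polyC !hornerE.
set u := _.[x] in IH *; set v := _.[y] in IH *.
have -> : u * x + c%:~R - (v * y + c%:~R) = x * (u - v) + v * (x - y).
  rewrite opprD addrACA subrr addr0 !mulrBr [x * u]mulrC [x * v]mulrC.
  by rewrite addrA subrK.
apply: (prime_idealD PP); apply: (prime_ideal_mull PP) => //.
exact: alg_integral_horner.
Qed.

(* Modulo [p], [0 = F(xi)^p = F(xi^p)], which is the product of the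
   [xi^p - s xi]; the prime [P] contains one of the factors. *)
Lemma exists_frobenius (N : int) :
  ~~ (p %| N)%Z ->
  (forall x, alg_integral x ->
    exists h : {poly int}, N%:~R * x = (map_poly intr h).[xi]) ->
  exists s, is_frobenius p P s.
Proof.
move=> pN NP; have ixi := alg_integral_xi.
have ixp := alg_integralX p ixi.
have := horner_pow_mod F ixi.
rewrite (rootP rootF) expr0n -(prednK (prime_gt0 pp)) /= subr0 prednK ?prime_gt0 //.
rewrite F_prod horner_prod.
case/(prime_ideal_prod PP) => [s|s].
  by rewrite !hornerE; apply: alg_integralB => //; apply: alg_integral_gal.
rewrite !hornerE => Ps; exists s => x ix; have [h hE] := NP x ix.
have isx := alg_integral_gal s ix; have isxi := alg_integral_gal s ixi.
have ixP := alg_integralX p ix.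
apply: (@prime_ideal_cancel _ _ _ pp PP N) => //; first exact: alg_integralB.
(* Fermat's little theorem, as the case of a constant polynomial; it lets the test for [x] be
   replaced by that for [N x]. *)
have [r rE] : exists r : int, N ^+ p = N + p%:R * r.
  have [r /(congr1 (horner^~ 0))] := int_poly_pow pp N%:P.
  rewrite horner_exp hornerD comp_polyC !hornerC => ->; exists r.[0].
  by rewrite hornerM -polyC_natr hornerC.
have -> : N%:~R * (s x - x ^+ p)
    = (p%:R * (r%:~R * x ^+ p)) + (s (N%:~R * x) - (N%:~R * x) ^+ p).
  rewrite exprMn -rmorphXn /= rE rmorphM rmorphD !rmorph_int rmorphM rmorph_nat /=.
  by rewrite mulrDl mulrBr opprD addrCA mulrA [p%:R * _ * _ + _]addrCA subrr addr0.
apply: (prime_idealD PP).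
  by apply/prime_ideal_mulp/alg_integralM => //; apply: alg_integral_int.
rewrite hE; set hs := s _.
have -> : hs = (map_poly intr h).[s xi].
  rewrite /hs -horner_map -map_poly_comp; congr _.[_].
  by apply: eq_map_poly => z /=; rewrite rmorph_int.
(* Go through [h(xi^p)]: it is congruent to [h(s xi)] by the choice of [s], and to [h(xi)^p] modulo
   [p]. *)
rewrite -(subrK (map_poly intr h).[xi ^+ p] (map_poly intr h).[s xi]) -addrA.
apply: (prime_idealD PP); last exact: horner_pow_mod.
apply: horner_mod => //; rewrite -opprB; exact: (prime_idealN PP).
Qed.

(** The witness is the image of [P] under [g]: products act from left to right, so [s ^ g] sends [x]
    to [g (s (g^-1 x))]. *)
Lemma frobenius_conj (s g : G) : is_frobenius p P s ->
  exists P', prime_ideal_above p P' /\ is_frobenius p P' (s ^ g)%g.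
Proof.
move=> Fs; exists (fun x => P (g^-1%g x)); split; last first.
  move=> x ix; rewrite !galE rmorphB rmorphXn /= -[g^-1%g (g _)]galE mulgV gal_id.
  by apply/Fs/alg_integral_gal.
have [Pi [P0 [PD [PM [P1 [Pprime Pp]]]]]] := PP.
split=> [x /Pi ix|]; first by rewrite -[x](galVK g); apply: alg_integral_gal.
split; first by rewrite rmorph0.
split=> [x y Px Py|]; first by rewrite rmorphD; apply: PD.
split=> [x y iy Px|]; first by rewrite rmorphM; apply: PM => //; apply: alg_integral_gal.
split; first by rewrite rmorph1.
split=> [x y ix iy|]; first by rewrite rmorphM; apply: Pprime; apply: alg_integral_gal.
by rewrite rmorph_nat.
Qed.

End Frobenius.

(** * The dual element [w] of a conjugacy class *)

Section IndicatorDual.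
Variable j : 'I_#|classes [set: G]|.
Local Notation K := (class_at j).

Let u (t : G) : L := (invmx (Gammamat xi) *m kappamat L) (enum_rank t) j.
Let w : L := u 1%g.

Lemma class_at_conj (s g : G) : (s ^ g \in K)%g = (s \in K).
Proof.
rewrite /class_at; have /imsetP [x _ ->] := enum_valP j.
suff H (a b : G) : (a \in x ^: [set: G] -> a ^ b \in x ^: [set: G])%g.
  by apply/idP/idP => [/(H _ g^-1%g)|/(H _ g)]; rewrite ?conjgK.
by move=> /imsetP [c _ ->]; rewrite -conjgM; apply: memJ_class; rewrite inE.
Qed.

Lemma indicator_coords (s : G) : \sum_(t : G) s (t^-1%g xi) * u t = (s \in K)%:R.
Proof.
have /matrixP/(_ (enum_rank s) j) :
    Gammamat xi *m (invmx (Gammamat xi) *m kappamat L) = kappamat L.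
  by rewrite mulKVmx // Gammamat_unit.
rewrite [in LHS]mxE [in RHS]mxE gal_at_rank => e.
have -> : (s \in K)%:R = (if s \in K then 1 else 0) :> L by case: ifP.
rewrite -e -sum_gal_at; apply: eq_bigr => i _.
by rewrite [in RHS]mxE gal_at_rank /u enum_rank_gal_at.
Qed.

Lemma indicator_coords_uniq (v : G -> L) :
  (forall s : G, \sum_(t : G) s (t^-1%g xi) * v t = (s \in K)%:R) -> v =1 u.
Proof.
move=> vK t; pose V := \col_i v (@gal_at L i); pose U := \col_i u (@gal_at L i).
have GV : Gammamat xi *m V = Gammamat xi *m U.
  apply/colP => i; rewrite !mxE.
  transitivity ((gal_at i \in K)%:R : L); [rewrite -vK | rewrite -indicator_coords];
    by rewrite -sum_gal_at; apply: eq_bigr => k _; rewrite !mxE.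
have /colP/(_ (enum_rank t)) : V = U.
  by rewrite -[V](mulKmx Gammamat_unit) GV (mulKmx Gammamat_unit).
by rewrite !mxE gal_at_rank.
Qed.

(* Both sides solve the same system, because [K] is stable under conjugation. *)
Lemma indicator_coordsE (t : G) : u t = t^-1%g w.
Proof.
suff H (g : G) : (fun t => g (u (g * t)%g)) =1 u.
  (* [H] for [g = t], at the identity, reads [t (u t) = w]. *)
  by rewrite /w -(H t 1%g) mulg1 -galE mulgV gal_id.
apply: indicator_coords_uniq => s.
(* Apply [g] to the equation of the conjugate [s ^ g^-1], whose right side is the same, and reindex
   the sum by [t = g * t']. *)
transitivity (g (s \in K)%:R); last by rewrite rmorph_nat.
rewrite -(class_at_conj s g^-1%g) -indicator_coords rmorph_sum /=.
rewrite [RHS](reindex_inj (mulgI g)) /=; apply: eq_bigr => t' _.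
rewrite rmorphM /= -!galE; congr (_ xi * _).
by rewrite /conjg !invgK !invMg !mulgA mulgKV mulgVK.
Qed.

(** The column of Gamma_xi^-1 kappa consists of the [t^-1 w] and row [i] of [Pmat] of the
    [t^-1 (xi ^+ i)], so an entry of the product is a trace. *)
Lemma indicator_dual : exists w : L,
  (forall s : G, \sum_(t : G) s (t^-1%g xi) * t^-1%g w = (s \in K)%:R) /\
  (forall d (i : 'I_d), (Pmat d xi *m invmx (Gammamat xi) *m kappamat L) i j
    = \sum_(t : G) t^-1%g (xi ^+ i * w)).
Proof.
exists w; split=> [s|d i].
  by rewrite -indicator_coords; apply: eq_bigr => t _; rewrite indicator_coordsE.
rewrite -mulmxA mxE -sum_gal_at; apply: eq_bigr => k _.
rewrite mxE rmorphM /= -indicator_coordsE /u.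
by rewrite enum_rank_gal_at.
Qed.

End IndicatorDual.

(** * Traces, the recurrence and the congruence *)

Lemma gal_sum_rat x : exists a : rat, \sum_(t : G) t^-1%g x = a%:A.
Proof.
apply: gal_fixed_rat => s; rewrite rmorph_sum /= (reindex_inj (mulgI s)) /=.
by apply: eq_bigr => t _; rewrite -galE invMg mulgKV.
Qed.

(** Multiplying [F(xi) = 0] by [xi ^+ m * w] and taking traces gives the same recurrence on the
    right side. *)
Lemma rec_gal_sum (a : nat -> rat) (w : L) :
  (forall i, (i < (size F).-1)%N -> (a i)%:A = \sum_(t : G) t^-1%g (xi ^+ i * w)) ->
  (forall n, a (n + (size F).-1)%N
    = - \sum_(k < (size F).-1) (F`_k)%:~R * a (n + k)%N) ->
  forall n, (a n)%:A = \sum_(t : G) t^-1%g (xi ^+ n * w).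
Proof.
set d := (size F).-1 => a_init a_rec.
have xi_d : xi ^+ d = - \sum_(k < d) (F`_k)%:~R * xi ^+ k.
  apply/eqP; rewrite -addr_eq0 addrC; move: rootF; rewrite rootE horner_coef.
  rewrite map_intr_in_alg size_map_poly size_map_inj_poly; [|exact: intr_inj|by []].
  rewrite -(prednK (ltnW size_F_gt1)) -/d big_ord_recr /= -map_intr_in_alg.
  rewrite [(map_poly _ _)`_d]coef_map -[F`_d]/(lead_coef F) (monicP mF) mul1r.
  by under eq_bigr => k _ do rewrite coef_map.
elim/ltn_ind => n IHn; case: (ltnP n d) => [/a_init //|/subnK nE].
rewrite -nE in IHn *; set m := (n - d)%N in IHn *.
rewrite a_rec exprD xi_d mulrN mulNr scaleNr; under [RHS]eq_bigr do rewrite rmorphN.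
rewrite sumrN; congr (- _); rewrite scaler_suml.
under [RHS]eq_bigr do rewrite mulr_sumr mulr_suml rmorph_sum.
rewrite exchange_big /=; apply: eq_bigr => k _.
rewrite -scalerA scaler_int IHn ?ltn_add2l // -mulrzl mulr_sumr.
apply: eq_bigr => t _.
have -> : xi ^+ m * ((F`_k)%:~R * xi ^+ k) * w = (F`_k)%:~R * (xi ^+ (m + k) * w).
  by rewrite exprD; ring.
by rewrite [RHS]rmorphM rmorph_int.
Qed.

(** The factor [D] makes every term integral, so that [D * a] is an integer; an integer lying in [P]
    is divisible by [p], which turns the congruence modulo [P] into one modulo [p]. *)
Lemma cong_frobenius (p : nat) (P : L -> Prop) (s : G) (K : {set G}) (w : L)
    (D : int) (a : rat) :
  prime p -> prime_ideal_above p P -> is_frobenius p P s ->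
  ~~ (p %| D)%Z -> alg_integral (D%:~R * w) ->
  \sum_(t : G) s (t^-1%g xi) * t^-1%g w = (s \in K)%:R ->
  a%:A = \sum_(t : G) t^-1%g (xi ^+ p * w) ->
  p_integral p a /\ cong_mod_p p a (s \in K)%:R.
Proof.
move=> pp PP Fs pD iw sK aE.
have DaE : (D%:~R * a)%:A = \sum_(t : G) (t^-1%g xi) ^+ p * t^-1%g (D%:~R * w).
  rewrite -scalerA scaler_int aE -mulrzl mulr_sumr; apply: eq_bigr => t _.
  by rewrite -rmorphXn -[in RHS]rmorphM mulrCA [in RHS]rmorphM rmorph_int.
have ixi (t : G) : alg_integral (t xi) by apply/alg_integral_gal/alg_integral_xi.
have [z zE] : exists z : int, D%:~R * a = z%:~R.
  apply: (@alg_integral_rat L); rewrite DaE; apply: alg_integral_sum => t _.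
  by apply: alg_integralM; [apply: alg_integralX | apply: alg_integral_gal].
split; first exact: p_integral_div pD zE.
have /(prime_ideal_int pp PP) /dvdzP [q qE] : P (z - D * (s \in K)%:R)%:~R.
  rewrite rmorphB rmorphM rmorph_nat /= -sK -in_alg_int -zE DaE mulr_sumr -sumrB.
  apply: (prime_ideal_sum PP) => t _.
  have -> : D%:~R * (s (t^-1%g xi) * t^-1%g w) = s (t^-1%g xi) * t^-1%g (D%:~R * w).
    by rewrite [in RHS]rmorphM rmorph_int mulrCA.
  rewrite -mulrBl mulrC; apply: (prime_ideal_mull PP); first exact: alg_integral_gal.
  by rewrite -opprB; apply/(prime_idealN PP)/Fs.
apply: (@cong_mod_p_div p _ _ D q) => //.
by rewrite mulrBr zE -[(s \in K)%:R](rmorph_nat intr) -rmorphM -rmorphB qE rmorphM mulrC.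
Qed.

End NormalBasis.

Theorem theorem1p1 (L : splittingFieldType rat) (F : {poly int}) (xi : L) :
  F \is monic ->
  irreducible_poly (map_poly (fun z : int => z%:~R : rat) F) ->
  root (map_poly (fun z : int => z%:~R : L) F) xi ->
  <<1; xi>>%VS = fullv ->
  galois 1%VS {:L} ->
  \dim {:L} = (size F).-1 ->
  basis_of fullv (map (fun s : gal_of {:L} => s xi) (enum [set: gal_of {:L}])) ->
  let d := (size F).-1 in
  let A := Pmat d xi *m invmx (Gammamat xi) *m kappamat L in
  Gammamat xi \in unitmx /\
  (forall i j, A i j \in 1%VS) /\
  (forall (j : 'I_#|classes [set: gal_of {:L}]|) (a : nat -> rat),
     (forall i : 'I_d, A i j = (a i)%:A) ->
     (forall n, a (n + d)%N = - \sum_(k < d) (F`_k)%:~R * a (n + k)%N) ->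
     exists N : nat, forall p : nat, prime p -> (N < p)%N ->
       p_integral p (a p) /\
       (frob_in p (class_at j) -> cong_mod_p p (a p) 1) /\
       (~ frob_in p (class_at j) -> cong_mod_p p (a p) 0)).
Proof.
move=> mF irrF rootF gen galL dimL basisL d A.
have unitG := Gammamat_unit basisL.
split=> //; split=> [i j|j a a_init a_rec].
  have [w [_ ->]] := indicator_dual basisL j.
  by have [b ->] := gal_sum_rat galL (xi ^+ i * w); apply/vlineP; exists b.
have [w [wK AE]] := indicator_dual basisL j.
have aE : forall n, (a n)%:A = \sum_(t : gal_of {:L}) t^-1%g (xi ^+ n * w).
  apply: (@rec_gal_sum _ F) => // i lt_id.
  by rewrite -(a_init (Ordinal lt_id)) AE.
have [D Dn0 [h hE]] := common_denominator gen (fun _ : unit => w).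
have [N Nn0 NP] := integral_index mF rootF gen basisL.
(* Primes beyond this bound divide neither [D], which controls [w], nor [N], which controls the
   primes above [p] and their Frobenius elements. *)
exists (absz (D * N)) => p pp lt_p.
have [pD pN] : ~~ (p %| D)%Z /\ ~~ (p %| N)%Z.
  have : ~~ (p %| D * N)%Z.
    rewrite dvdzE /=; apply/negP => /dvdn_leq.
    by rewrite absz_gt0 mulf_neq0 // => /(_ isT); rewrite leqNgt lt_p.
  by move=> pDN; split; apply: contra pDN => ?; [apply: dvdz_mulr | apply: dvdz_mull].
have iw : alg_integral (D%:~R * w).
  by rewrite (hE tt); apply/alg_integral_horner/(alg_integral_xi mF).
have main P s : prime_ideal_above p P -> is_frobenius p P s ->
    p_integral p (a p) /\ cong_mod_p p (a p) (s \in class_at j)%:R.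
  by move=> PP Fs; apply: (cong_frobenius mF rootF pp PP Fs pD iw).
have [P PP] := exists_prime_above mF irrF rootF pp pN NP.
have [s Fs] := exists_frobenius mF irrF rootF dimL basisL pp PP pN NP.
have [pa _] := main _ _ PP Fs; split=> //; split=> [fj|not_fj].
  have [r r_in] : exists r, r \in class_at j.
    rewrite /class_at; have /imsetP [x _ ->] := enum_valP j; exists x; exact: class_refl.
  have [P' [PP' Fr]] := (fj r).2 r_in.
  by have [_] := main _ _ PP' Fr; rewrite r_in.
(* [p]-integrality is decidable: if the congruence to 0 fails, every Frobenius element must lie in
   the class. *)
have [//|ncong] := boolP (~~ (p %| `|denq ((a p - 0) / p%:R)|)%N).
have inK P' r : prime_ideal_above p P' -> is_frobenius p P' r -> r \in class_at j.
  move=> PP' Fr; have [_] := main _ _ PP' Fr; case: (r \in _) => //.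
  by rewrite /cong_mod_p /p_integral (negPf ncong).
case: not_fj => r; split=> [[P' [PP' /(inK _ _ PP')]] //|].
(* Conversely, the class is the conjugation orbit of the Frobenius [s], so all its members are
   Frobenius elements. *)
move: (inK _ _ PP Fs); rewrite /class_at; have /imsetP [x _ ->] := enum_valP j.
move=> /class_eqP <- /imsetP [g _ ->].
exact: (frobenius_conj PP g Fs).
Qed.
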